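(* Let $n,m\ge1$ be integers. The vertex-face walk on the toroidal $(n,m)$-grid is periodic if and only if $\min\{n,m\}\le2$ or $n=m=4$.
   Context: Toroidal $(n,m)$-grid ($n,m\ge1$): the embedding of $C_n\square C_m$ in the torus (a multigraph with doubled edges or loops if $n$ or $m$ is $2$ or $1$). Concretely: the vertex set is $V=\mathbb{Z}_n\times\mathbb{Z}_m$; with $e_1=(1,0)$, $e_2=(0,1)$, the set $\mathcal{A}$ of arcs consists of the $4nm$ pairs $(x,s)$ with $x\in V$ and $s\in\{+e_1,-e_1,+e_2,-e_2\}$ (four formally distinct directions, even if $n$ or $m$ is $1$ or $2$), the arc $(x,s)$ having tail $x$ and head $x+s$. The face set is $F=\mathbb{Z}_n\times\mathbb{Z}_m$, where the arcs lying inside face $f$ are the four arcs $(f,+e_1)$, $(f+e_1,+e_2)$, $(f+e_1+e_2,-e_1)$, $(f+e_2,-e_2)$ (the boundary walk of the unit square with corner $f$); each arc lies inside exactly one face. Vertex-face walk: $N\in\mathbb{R}^{\mathcal{A}\times V}$ has $N(a,x)=\frac12$ if $x$ is the tail of $a$ and $0$ otherwise; $M\in\mathbb{R}^{\mathcal{A}\times F}$ has $M(a,f)=\frac12$ if $a$ lies inside $f$ and $0$ otherwise. The transition matrix is $U=(2MM^T-I)(2NN^T-I)$. The walk is periodic at vertex $x$ if there are an integer $t>0$ and $\gamma\in\mathbb{C}$ with $|\gamma|=1$ such that $U^tN\mathbf{e}_x=\gamma N\mathbf{e}_x$. The walk on the grid is called periodic if it is periodic at every vertex; for toroidal grids this is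 equivalent to periodicity at one vertex, and also to $U^\tau=I$ for some integer $\tau>0$. *)

(* Defs.v *)
From HB Require Import structures.
From mathcomp Require Import all_boot all_order all_algebra.
From mathcomp Require Import reals.
From mathcomp Require Import complex.

Set Implicit Arguments.
Unset Strict Implicit.
Unset Printing Implicit Defensive.

Import Order.TTheory GRing.Theory Num.Theory.

Local Open Scope ring_scope.

(* Z_n is represented by 'I_n with the cyclic successor ordS and predecessor
   ord_pred.  Unlike 'Z_n (which is Z/2 for n = 1), this is correct for every
   n >= 1: for n = 1 both maps are the identity. *)
Definition grid_vertex (n m : nat) : finType := ('I_n * 'I_m)%type.
Definition grid_face (n m : nat) : finType := ('I_n * 'I_m)%type.

(* The four directions +e_1, -e_1, +e_2, -e_2, which stay distinct even when
   the corresponding translations coincide. *)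
Inductive direction : predArgType := PosE1 | NegE1 | PosE2 | NegE2.

Definition direction_code (s : direction) : bool * bool :=
  match s with
  | PosE1 => (false, false)
  | NegE1 => (false, true)
  | PosE2 => (true, false)
  | NegE2 => (true, true)
  end.

Definition direction_decode (b : bool * bool) : direction :=
  match b with
  | (false, false) => PosE1
  | (false, true) => NegE1
  | (true, false) => PosE2
  | (true, true) => NegE2
  end.

Lemma direction_codeK : cancel direction_code direction_decode.
Proof. by case. Qed.

HB.instance Definition _ := Finite.copy direction (can_type direction_codeK).

Definition grid_arc (n m : nat) : finType := (grid_vertex n m * direction)%type.

Definition grid_step (n m : nat) (x : grid_vertex n m) (s : direction) : grid_vertex n m :=
  match s with
  | PosE1 => (ordS x.1, x.2)
  | NegE1 => (ord_pred x.1, x.2)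
  | PosE2 => (x.1, ordS x.2)
  | NegE2 => (x.1, ord_pred x.2)
  end.

Definition arc_tail (n m : nat) (a : grid_arc n m) : grid_vertex n m := a.1.
Definition arc_head (n m : nat) (a : grid_arc n m) : grid_vertex n m := grid_step a.1 a.2.

Definition face_arcs (n m : nat) (f : grid_face n m) : seq (grid_arc n m) :=
  [:: (f, PosE1);
      (grid_step f PosE1, PosE2);
      (grid_step (grid_step f PosE1) PosE2, NegE1);
      (grid_step f PosE2, NegE2)].

(* Matrices indexed by finite types are indexed by the canonical enumerations
   of these types (enum_rank / enum_val). *)
Definition vertex_mx (R : realType) (n m : nat) :
    'M[R]_(#|grid_arc n m|, #|grid_vertex n m|) :=
  \matrix_(a, x) (if arc_tail (enum_val a) == enum_val x then 2^-1 else 0).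

Definition face_mx (R : realType) (n m : nat) :
    'M[R]_(#|grid_arc n m|, #|grid_face n m|) :=
  \matrix_(a, f) (if enum_val a \in face_arcs (enum_val f) then 2^-1 else 0).

Definition transition_mx (R : realType) (n m : nat) : 'M[R]_#|grid_arc n m| :=
  let N := vertex_mx R n m in
  let M := face_mx R n m in
  (2 *: (M *m M^T) - 1%:M) *m (2 *: (N *m N^T) - 1%:M).

(* N e_x, as a real column vector. *)
Definition vertex_state (R : realType) (n m : nat) (x : grid_vertex n m) :
    'cV[R]_#|grid_arc n m| :=
  vertex_mx R n m *m delta_mx (enum_rank x) 0.

(* The real vectors U^t N e_x and N e_x are compared over R[i]. *)
Definition periodic_at (R : realType) (n m : nat) (x : grid_vertex n m) : Prop :=
  exists (t : nat) (gamma : R[i]),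
    [/\ (0 < t)%N, `|gamma| = 1 &
      map_mx (real_complex R) (transition_mx R n m ^+ t *m vertex_state R x) =
        gamma *: map_mx (real_complex R) (vertex_state R x)].

Definition grid_periodic (R : realType) (n m : nat) : Prop :=
  forall x : grid_vertex n m, periodic_at R x.

(* Main.v *)
Require Import Defs.
From mathcomp Require Import all_boot all_order all_algebra.
From mathcomp Require Import reals.
From mathcomp Require Import cyclic separable algC cyclotomic algnum.
From mathcomp Require Import complex zify ring.

(** Write N and M for the vertex and face matrices. Both have orthonormal
    columns, so U is a product of two reflections, and it is understood through
    the singular values of the matrix N^T M, which commutes with translations
    of the torus. For z^n = w^m = 1 the character chi(i, j) = z^i w^j, as a row
    vector over the complex numbers, satisfies
      chi N^T M = al chi    and    chi M^T N = be chi,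
    where al = (1 + z) (1 + w) / 4 and be = (1 + z^-1) (1 + w^-1) / 4. The row
    r = chi N^T then obeys r U^2 = (4 al be - 2) (r U) - r
    ([singular_pair_recurrence]), whence
      chi N^T U^t N = (u^t + u^-t) / 2 chi    if u + u^-1 = 4 al be - 2
    ([singular_pair_moments], [character_moments]). With
    A(z) = (1 + z) (1 + z^-1), one has 4 al be - 2 = A(z) A(w) / 4 - 2.

    If the walk is periodic at x with period t, the trivial character shows
    that the phase is 1, and then u^t = 1 for every character
    ([periodic_at_characters]). Conversely, suppose u^t = 1 for all characters.
    As characters span all row vectors, e_x^T N^T U^t N e_x = 1, and since U is
    real orthogonal and N e_x is a unit vector this forces U^t N e_x = N e_x
    ([characters_periodic]).

    It remains to decide when all the u are roots of unity. If they are, each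
    A(z) A(w) / 4 is an algebraic integer ([periodic_at_integral]). When z has
    odd order greater than 1, A(z) is a unit; moreover A('i) = 2. Hence, if
    n, m > 2 and one of them has an odd divisor greater than 1, then 1/2 would
    be an algebraic integer ([integral_odd_divisor]). The same contradiction
    arises from z = 'i and w of order 8 when 4 | n and 8 | m
    ([integral_eighth_root]). Only n = m = 4 is left. In the remaining cases
    the u are explicit: if z = 1 then u = w, if z = -1 then u = -1, and for
    n = m = 4 the sums u + u^-1 lie in {2, 0, -1, -2}, so that u^12 = 1. *)

Set Implicit Arguments.
Unset Strict Implicit.
Unset Printing Implicit Defensive.

Import Order.TTheory GRing.Theory Num.Theory.

Local Open Scope ring_scope.

(** * Products of two reflections *)

(** The matrix 2 N N^T - 1; it is the orthogonal reflection across the column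
    space of N when the columns of N are orthonormal. *)
Definition reflection (K : fieldType) (a v : nat) (N : 'M[K]_(a, v)) : 'M[K]_a :=
  2 *: (N *m N^T) - 1%:M.

Lemma tr_reflection (K : fieldType) (a v : nat) (N : 'M[K]_(a, v)) :
  (reflection N)^T = reflection N.
Proof.
by rewrite /reflection linearB linearZ /= trmx_mul trmxK trmx1.
Qed.

Lemma reflectionK (K : fieldType) (a v : nat) (N : 'M[K]_(a, v)) :
  N^T *m N = 1%:M -> reflection N *m reflection N = 1%:M.
Proof.
move=> NN; rewrite /reflection mulmxBl mul1mx mulmxBr mulmx1.
rewrite -scalemxAl -scalemxAr mulmxA -(mulmxA N) NN mulmx1 scalerA.
by apply/matrixP=> i j; move: (N *m N^T) => A; rewrite !mxE; ring.
Qed.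

Lemma reflection_product_orthogonal (K : fieldType) (a v f : nat)
    (N : 'M[K]_(a, v)) (M : 'M[K]_(a, f)) (U := reflection M *m reflection N) :
  N^T *m N = 1%:M -> M^T *m M = 1%:M -> U^T *m U = 1%:M.
Proof.
move=> NN MM; rewrite trmx_mul !tr_reflection -mulmxA.
by rewrite [X in _ *m X]mulmxA reflectionK // mul1mx reflectionK.
Qed.

(** The span of c N^T and d M^T is stable under U and under U^-1 = U^T,
    and c N^T (U + U^-1) = (4 al be - 2) c N^T. *)
Lemma singular_pair_recurrence (K : fieldType) (a v f : nat)
    (N : 'M[K]_(a, v)) (M : 'M[K]_(a, f)) (c : 'rV[K]_v) (d : 'rV[K]_f)
    (al be : K) (U := reflection M *m reflection N) (r := c *m N^T) :
  N^T *m N = 1%:M -> M^T *m M = 1%:M ->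
  r *m M = al *: d -> d *m M^T *m N = be *: c ->
  r *m U *m N = (2 * (al * be) - 1) *: c /\
  r *m U *m U = (4 * (al * be) - 2) *: (r *m U) - r.
Proof.
move=> NN MM rM dN.
have rN : r *m N = c by rewrite /r -mulmxA NN mulmx1.
have rRM : r *m reflection M = (2 * al) *: (d *m M^T) - r.
  by rewrite /reflection mulmxBr mulmx1 -scalemxAr mulmxA rM -scalemxAl scalerA.
have rRN : r *m reflection N = r.
  rewrite /reflection mulmxBr mulmx1 -scalemxAr mulmxA rN.
  by rewrite -/r scaler_nat mulr2n addrK.
have rU : r *m U = (4 * (al * be) - 1) *: r - (2 * al) *: (d *m M^T).
  rewrite /U mulmxA rRM mulmxBl rRN -scalemxAl.
  rewrite [d *m M^T *m _]mulmxBr mulmx1 -scalemxAr mulmxA dN -scalemxAl -/r.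
  rewrite scalerBr !scalerA.
  have -> : 2 * al * (2 * be) = 4 * (al * be) :> K by ring.
  by rewrite scalerBl scale1r addrAC.
split.
  rewrite rU mulmxBl -!scalemxAl rN dN scalerA -scalerBl; congr (_ *: _); ring.
have sum_r : r *m U + r *m U^T = (4 * (al * be) - 2) *: r.
  rewrite rU /U trmx_mul !tr_reflection mulmxA rRN rRM addrA subrK.
  by rewrite -[X in _ - X]scale1r -scalerBl; congr (_ *: _); ring.
have UU : U^T *m U = 1%:M by apply: reflection_product_orthogonal.
move/(congr1 (mulmx^~ U)): sum_r; rewrite mulmxDl -[r *m U^T *m U]mulmxA UU mulmx1.
by rewrite -scalemxAl => <-; rewrite addrK.
Qed.

(** The recurrence of [singular_pair_recurrence] has characteristic roots u and
    u^-1, and the two initial values make both coefficients equal to 1/2. *)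
Lemma singular_pair_moments (K : fieldType) (a v f : nat)
    (N : 'M[K]_(a, v)) (M : 'M[K]_(a, f)) (c : 'rV[K]_v) (d : 'rV[K]_f)
    (al be u : K) (U := reflection M *m reflection N) (s : nat) :
  2 != 0 :> K ->
  N^T *m N = 1%:M -> M^T *m M = 1%:M ->
  c *m N^T *m M = al *: d -> d *m M^T *m N = be *: c ->
  u != 0 -> u + u^-1 = 4 * (al * be) - 2 ->
  c *m N^T *m U ^+ s *m N = (2^-1 * (u ^+ s + u^-1 ^+ s)) *: c.
Proof.
move=> nz2 NN MM cM dN u0 Eu.
have [q1 rec] := singular_pair_recurrence NN MM cM dN.
rewrite -/U -Eu in q1 rec.
suff [] : c *m N^T *m U ^+ s *m N = (2^-1 * (u ^+ s + u^-1 ^+ s)) *: c /\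
    c *m N^T *m U ^+ s.+1 *m N = (2^-1 * (u ^+ s.+1 + u^-1 ^+ s.+1)) *: c by [].
elim: s => [|s [IH0 IH1]].
  split.
    rewrite !expr0 mulmx1 -mulmxA NN mulmx1 -[LHS]scale1r; congr (_ *: _).
    by rewrite mulVf.
  rewrite expr1 q1; congr (_ *: _); rewrite !expr1 Eu; field.
  by rewrite nz2.
split=> //.
rewrite 2!exprS mulmxA [X in X *m N]mulmxA rec.
rewrite mulmxBl mulmxBl -2!scalemxAl IH0.
have := IH1; rewrite exprS mulmxA => ->.
rewrite scalerA -scalerBl; congr (_ *: _).
rewrite !exprS; field; by rewrite u0 nz2.
Qed.

(** * Incidence matrices of the grid *)

(** The row vector of the values of F along the enumeration of T. *)
Definition fun_row (K : fieldType) (T : finType) (F : T -> K) : 'rV[K]_#|T| :=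
  \row_i F (enum_val i).

(** The matrix with entry 1/2 at (a, x) when g a = x and 0 elsewhere. The vertex
    and face matrices are the cases where g gives the tail of an arc and the
    face that contains it. *)
Definition incidence_mx (K : fieldType) (n m : nat)
    (g : grid_arc n m -> grid_vertex n m) :
    'M[K]_(#|grid_arc n m|, #|grid_vertex n m|) :=
  \matrix_(a, x) (if g (enum_val a) == enum_val x then 2^-1 else 0).

Lemma fun_rowK (K : fieldType) (T : finType) (c : 'rV[K]_#|T|) :
  fun_row (fun x => c 0 (enum_rank x)) = c.
Proof. by apply/rowP=> i; rewrite mxE enum_valK. Qed.

Lemma fun_row_scale (K : fieldType) (T : finType) (al : K) (F : T -> K) :
  al *: fun_row F = fun_row (fun x => al * F x).
Proof. by apply/rowP=> i; rewrite !mxE. Qed.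

Lemma eq_fun_row (K : fieldType) (T : finType) (F G : T -> K) :
  F =1 G -> fun_row F = fun_row G.
Proof. by move=> FG; apply/rowP=> i; rewrite !mxE FG. Qed.

Lemma sum_enum_val (K : nmodType) (T : finType) (F : T -> K) :
  \sum_(i < #|T|) F (enum_val i) = \sum_x F x.
Proof. by rewrite -(big_enum_val (A := T)). Qed.

Lemma sum_direction (K : nmodType) (F : direction -> K) :
  \sum_s F s = F PosE1 + F NegE1 + F PosE2 + F NegE2.
Proof.
have codeK : cancel direction_decode direction_code by case=> [[] []].
rewrite (reindex direction_decode) /=; last first.
  by exists direction_code => x _; [apply: codeK | apply: direction_codeK].
transitivity (\sum_b1 \sum_b2 F (direction_decode (b1, b2))).
  by rewrite pair_bigA; apply: eq_bigr => -[].
by rewrite !big_bool /= addrC [F NegE1 + _]addrC [F NegE2 + _]addrC !addrA.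
Qed.

Lemma fun_row_mul_incidence_tr (K : fieldType) (n m : nat)
    (g : grid_arc n m -> grid_vertex n m) (F : grid_vertex n m -> K) :
  fun_row F *m (incidence_mx K g)^T = fun_row (fun a => 2^-1 * F (g a)).
Proof.
apply/rowP=> i; rewrite !mxE.
under eq_bigr do rewrite !mxE.
rewrite (sum_enum_val (fun x => F x * (if g (enum_val i) == x then 2^-1 else 0))).
rewrite (bigD1 (g (enum_val i))) //= eqxx big1 ?addr0 1?mulrC // => x.
by rewrite eq_sym => /negPf ->; rewrite mulr0.
Qed.

(** If, for each direction s, the arcs of direction s are in bijection with the
    vertices through g, then each fibre of g has one arc per direction. *)
Lemma fun_row_mul_incidence (K : fieldType) (n m : nat)
    (g : grid_arc n m -> grid_vertex n m)
    (h : direction -> grid_vertex n m -> grid_vertex n m)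
    (ghK : forall s, cancel (h s) (fun x => g (x, s)))
    (hgK : forall s, cancel (fun x => g (x, s)) (h s))
    (D : grid_arc n m -> K) :
  fun_row D *m incidence_mx K g =
    fun_row (fun x => 2^-1 * \sum_s D (h s x, s)).
Proof.
apply/rowP=> i; rewrite !mxE.
under eq_bigr do rewrite !mxE.
rewrite (sum_enum_val (fun a => D a * (if g a == enum_val i then 2^-1 else 0))).
set y := enum_val i.
transitivity (\sum_x \sum_s D (x, s) * (if g (x, s) == y then 2^-1 else 0)).
  by rewrite pair_bigA; apply: eq_bigr => -[].
have gh s x : g (h s x, s) = x := ghK s x.
have hg s x : h s (g (x, s)) = x := hgK s x.
rewrite exchange_big mulr_sumr; apply: eq_bigr => s _.
rewrite (bigD1 (h s y)) //= gh eqxx big1 ?addr0 1?mulrC // => x x_neq.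
by case: eqP => [gx|_]; [rewrite -gx hg eqxx in x_neq | rewrite mulr0].
Qed.

Lemma incidence_mx_orthonormal (K : fieldType) (n m : nat)
    (g : grid_arc n m -> grid_vertex n m)
    (h : direction -> grid_vertex n m -> grid_vertex n m) :
  2 != 0 :> K ->
  (forall s, cancel (h s) (fun x => g (x, s))) ->
  (forall s, cancel (fun x => g (x, s)) (h s)) ->
  (incidence_mx K g)^T *m incidence_mx K g = 1%:M.
Proof.
move=> nz2 ghK hgK.
apply/row_matrixP=> i; rewrite row_mul row1.
rewrite -tr_col [X in X^T]colE trmx_mul trmx_delta.
rewrite -[delta_mx 0 i]fun_rowK fun_row_mul_incidence_tr.
rewrite (fun_row_mul_incidence ghK hgK); apply: eq_fun_row => x.
have gh s y : g (h s y, s) = y := ghK s y.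
by rewrite sum_direction !gh; field; rewrite nz2.
Qed.

(** The unique face that contains the arc a. *)
Definition left_face (n m : nat) (a : grid_arc n m) : grid_face n m :=
  match a.2 with
  | PosE1 => a.1
  | PosE2 => (ord_pred a.1.1, a.1.2)
  | NegE1 => (ord_pred a.1.1, ord_pred a.1.2)
  | NegE2 => (a.1.1, ord_pred a.1.2)
  end.

(** The tail of the arc of direction s inside the face f. *)
Definition face_corner (n m : nat) (s : direction) (f : grid_face n m) :
    grid_vertex n m :=
  match s with
  | PosE1 => f
  | PosE2 => (ordS f.1, f.2)
  | NegE1 => (ordS f.1, ordS f.2)
  | NegE2 => (f.1, ordS f.2)
  end.

Lemma face_cornerK (n m : nat) (s : direction) :
  cancel (@face_corner n m s) (fun x => left_face (x, s)).
Proof. by case: s => -[i j] //=; rewrite /left_face /= !ordSK. Qed.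

Lemma left_faceK (n m : nat) (s : direction) :
  cancel (fun x => left_face (x, s)) (@face_corner n m s).
Proof. by case: s => -[i j] //=; rewrite /left_face /= !ord_predK. Qed.

Lemma mem_face_arcs (n m : nat) (a : grid_arc n m) (f : grid_face n m) :
  (a \in face_arcs f) = (left_face a == f).
Proof.
apply/idP/eqP => [|<-].
  by rewrite !inE => /or4P[] /eqP -> ; rewrite /left_face /= ?ordSK //; case: f.
case: a => -[i j] s.
by rewrite !inE /grid_step /left_face; case: s => /=; rewrite ?ord_predK !eqxx ?orbT.
Qed.

Lemma vertex_mxE (R : realType) (n m : nat) :
  vertex_mx R n m = incidence_mx R (@arc_tail n m).
Proof. by []. Qed.

Lemma face_mxE (R : realType) (n m : nat) :
  face_mx R n m = incidence_mx R (@left_face n m).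
Proof. by apply/matrixP=> a f; rewrite !mxE mem_face_arcs. Qed.

Lemma map_incidence_mx (K L : fieldType) (phi : {rmorphism K -> L}) (n m : nat)
    (g : grid_arc n m -> grid_vertex n m) :
  map_mx phi (incidence_mx K g) = incidence_mx L g.
Proof.
apply/matrixP=> a x; rewrite !mxE; case: ifP => _; last exact: rmorph0.
by rewrite fmorphV rmorph_nat.
Qed.

(** * Characters of the torus *)

(** The character (i, j) |-> z^i w^j of Z_n x Z_m, for z^n = w^m = 1. The
    exponents are the representatives of i and j in {0, ..., n-1} and
    {0, ..., m-1}. *)
Definition grid_character (K : fieldType) (n m : nat) (z w : K)
    (x : grid_vertex n m) : K := z ^+ x.1 * w ^+ x.2.

Lemma grid_characterE (K : fieldType) (n m : nat) (z w : K) (i : 'I_n)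
    (j : 'I_m) : grid_character z w (i, j) = z ^+ i * w ^+ j.
Proof. by []. Qed.

Lemma unity_root_neq0 (K : fieldType) (n : nat) (z : K) :
  (0 < n)%N -> z ^+ n = 1 -> z != 0.
Proof.
move=> n_gt0; apply: contra_eq_neq => ->.
by rewrite expr0n gtn_eqF // eq_sym oner_eq0.
Qed.

Lemma expr_ordS (K : fieldType) (n : nat) (z : K) (i : 'I_n) :
  z ^+ n = 1 -> z ^+ (ordS i) = z * z ^+ i.
Proof. by move=> zn; rewrite /= expr_mod // exprS. Qed.

Lemma expr_ord_pred (K : fieldType) (n : nat) (z : K) (i : 'I_n) :
  z ^+ n = 1 -> z ^+ (ord_pred i) = z^-1 * z ^+ i.
Proof.
move=> zn; have n_gt0 : (0 < n)%N by apply: leq_ltn_trans (ltn_ord i).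
have z0 : z != 0 by apply: unity_root_neq0 zn.
by rewrite -[in RHS](ord_predK i) (expr_ordS _ zn) mulKf.
Qed.

Lemma grid_character_corners (K : fieldType) (n m : nat) (z w : K) :
  2 != 0 :> K -> z ^+ n = 1 -> w ^+ m = 1 ->
  fun_row (@grid_character K n m z w) *m (incidence_mx K (@arc_tail n m))^T
    *m incidence_mx K (@left_face n m) =
  (4^-1 * ((1 + z) * (1 + w))) *: fun_row (@grid_character K n m z w).
Proof.
move=> nz2 zn wm; rewrite fun_row_mul_incidence_tr.
rewrite (fun_row_mul_incidence (@face_cornerK n m) (@left_faceK n m)).
rewrite fun_row_scale; apply: eq_fun_row => -[i j].
rewrite sum_direction /arc_tail /= !grid_characterE !expr_ordS //.
have nz4 : 4 != 0 :> K by rewrite (natrM K 2 2) mulf_neq0.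
by field; rewrite nz4 nz2.
Qed.

Lemma grid_character_faces (K : fieldType) (n m : nat) (z w : K) :
  2 != 0 :> K -> z ^+ n = 1 -> w ^+ m = 1 ->
  fun_row (@grid_character K n m z w) *m (incidence_mx K (@left_face n m))^T
    *m incidence_mx K (@arc_tail n m) =
  (4^-1 * ((1 + z^-1) * (1 + w^-1))) *: fun_row (@grid_character K n m z w).
Proof.
move=> nz2 zn wm; rewrite fun_row_mul_incidence_tr.
rewrite (@fun_row_mul_incidence _ _ _ (@arc_tail n m) (fun=> id)) //.
rewrite fun_row_scale; apply: eq_fun_row => -[i j].
rewrite sum_direction /left_face /= !grid_characterE !expr_ord_pred //.
have nz4 : 4 != 0 :> K by rewrite (natrM K 2 2) mulf_neq0.
move: z^-1 w^-1 => z' w'; by field; rewrite nz4 nz2.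
Qed.

(** The number A(z) = (1 + z) (1 + z^-1), which is |1 + z|^2 for a root of unity
    z. *)
Definition char_norm (K : fieldType) (z : K) : K := (1 + z) * (1 + z^-1).

Lemma vertex_mx_orthonormal (K : fieldType) (n m : nat) :
  2 != 0 :> K ->
  (incidence_mx K (@arc_tail n m))^T *m incidence_mx K (@arc_tail n m) = 1%:M.
Proof.
by move=> nz2; apply: (incidence_mx_orthonormal (h := fun=> id)).
Qed.

Lemma face_mx_orthonormal (K : fieldType) (n m : nat) :
  2 != 0 :> K ->
  (incidence_mx K (@left_face n m))^T *m incidence_mx K (@left_face n m) = 1%:M.
Proof.
move=> nz2.
by apply: (incidence_mx_orthonormal _ (@face_cornerK n m) (@left_faceK n m)).
Qed.

Lemma transition_mxE (R : realType) (n m : nat) :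
  transition_mx R n m =
  reflection (incidence_mx R (@left_face n m)) *m
  reflection (incidence_mx R (@arc_tail n m)).
Proof. by rewrite /transition_mx face_mxE vertex_mxE. Qed.

Lemma map_reflection (K L : fieldType) (phi : {rmorphism K -> L}) (a v : nat)
    (N : 'M[K]_(a, v)) :
  map_mx phi (reflection N) = reflection (map_mx phi N).
Proof.
by rewrite /reflection map_mxB map_mxZ map_mxM -map_trmx map_mx1 rmorph_nat.
Qed.

Lemma map_mx_exp (K L : fieldType) (phi : {rmorphism K -> L}) (k t : nat)
    (A : 'M[K]_k) :
  map_mx phi (A ^+ t) = map_mx phi A ^+ t.
Proof.
elim: t => [|t IH]; first by rewrite !expr0 map_mx1.
by rewrite !exprS [A * _]/(A *m _) map_mxM IH.
Qed.

(** The left-hand side is the 1 x 1 matrix chi N^T U^t N e_x. *)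
Lemma character_moments (R : realType) (n m : nat) (x : grid_vertex n m)
    (z w u : R[i]) (t : nat) :
  z ^+ n = 1 -> w ^+ m = 1 -> u != 0 ->
  u + u^-1 = 4^-1 * (char_norm z * char_norm w) - 2 ->
  fun_row (@grid_character _ n m z w) *m (incidence_mx R[i] (@arc_tail n m))^T
    *m map_mx (real_complex R) (transition_mx R n m ^+ t *m vertex_state R x) =
  (2^-1 * (u ^+ t + u^-1 ^+ t) * grid_character z w x)%:M.
Proof.
move=> zn wm u0 Eu; have nz2 : 2 != 0 :> R[i] by rewrite pnatr_eq0.
have nz4 : 4 != 0 :> R[i] by rewrite pnatr_eq0.
rewrite /vertex_state vertex_mxE !map_mxM map_delta_mx map_mx_exp.
rewrite transition_mxE map_mxM !map_reflection !map_incidence_mx !mulmxA.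
rewrite (singular_pair_moments t nz2 (vertex_mx_orthonormal n m nz2)
  (face_mx_orthonormal n m nz2) (grid_character_corners nz2 zn wm)
  (grid_character_faces nz2 zn wm) u0); last first.
  rewrite Eu /char_norm; move: z^-1 w^-1 => z' w'.
  by field.
rewrite -scalemxAl -colE; apply/matrixP=> i j.
by rewrite !ord1 !mxE enum_rankK mulr1n.
Qed.

(** * From periodicity to roots of unity and back *)

Lemma periodic_at_characters (R : realType) (n m : nat) (x : grid_vertex n m) :
  periodic_at R x ->
  exists2 t, (0 < t)%N & forall z w u : R[i],
    z ^+ n = 1 -> w ^+ m = 1 -> u != 0 ->
    u + u^-1 = 4^-1 * (char_norm z * char_norm w) - 2 -> u ^+ t = 1.
Proof.
case=> t [gamma [t_gt0 _ per]]; exists t => //.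
have nz2 : 2 != 0 :> R[i] by rewrite pnatr_eq0.
have nz4 : 4 != 0 :> R[i] by rewrite pnatr_eq0.
have gammaE z w u : z ^+ n = 1 -> w ^+ m = 1 -> u != 0 ->
    u + u^-1 = 4^-1 * (char_norm z * char_norm w) - 2 ->
    2^-1 * (u ^+ t + u^-1 ^+ t) = gamma.
  move=> zn wm u0 Eu.
  have := character_moments x t zn wm u0 Eu.
  rewrite per -scalemxAr.
  have := character_moments x 0 zn wm u0 Eu.
  rewrite !expr0 mul1mx => -> /matrixP/(_ 0 0).
  rewrite !mxE !mulr1n mulVf // mul1r => E.
  have chi0 : grid_character z w x != 0.
    rewrite /grid_character mulf_neq0 // expf_neq0 //.
      by rewrite (unity_root_neq0 _ zn) // (leq_ltn_trans _ (ltn_ord x.1)).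
    by rewrite (unity_root_neq0 _ wm) // (leq_ltn_trans _ (ltn_ord x.2)).
  by apply: (mulIf chi0).
(* The trivial character has A(1) A(1) / 4 - 2 = 2, that is u = 1. *)
have gamma1 : gamma = 1.
  rewrite -(gammaE 1 1 1) ?expr1n ?oner_eq0 //.
    by rewrite invr1 expr1n mulVf.
  by rewrite /char_norm invr1; field.
move=> z w u zn wm u0 Eu.
have := gammaE z w u zn wm u0 Eu; rewrite gamma1 exprVn => E.
have ut0 : u ^+ t != 0 by rewrite expf_neq0.
(* u^t + u^-t = 2 says that u^t is a double root of X^2 - 2 X + 1. *)
have /eqP : (u ^+ t - 1) ^+ 2 = 0.
  apply: (mulfI (invr_neq0 ut0)); rewrite mulr0.
  transitivity (2 * (2^-1 * (u ^+ t + (u ^+ t)^-1)) - 2).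
    by field; rewrite ut0.
  by rewrite E mulr1 subrr.
by rewrite expf_eq0 /= subr_eq0 => /eqP.
Qed.

Lemma prim_root_orthogonality (K : fieldType) (n : nat) (z : K) (a b : 'I_n) :
  n.-primitive_root z ->
  \sum_(j < n) (z ^+ j)^-1 ^+ a * (z ^+ j) ^+ b = n%:R *+ (a == b).
Proof.
move=> prim_z; have n_gt0 := prim_order_gt0 prim_z.
have z0 : z != 0 by apply: unity_root_neq0 (prim_expr_order prim_z).
pose y := z ^+ b / z ^+ a.
transitivity (\sum_(j < n) y ^+ j).
  apply: eq_bigr => j _.
  by rewrite exprVn -!exprM ![(j * _)%N]mulnC !exprM -exprVn -exprMn mulrC.
have yn : y ^+ n = 1.
  rewrite expr_div_n -!exprM ![(_ * n)%N]mulnC !exprM.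
  by rewrite (prim_expr_order prim_z) !expr1n divr1.
have := subrX1 y n; rewrite yn subrr => /esym/eqP; rewrite mulf_eq0 subr_eq0.
have -> : (y == 1) = (a == b).
  rewrite /y (can2_eq (divfK _) (mulfK _)) ?expf_neq0 // mul1r.
  by rewrite (eq_prim_root_expr prim_z) !modn_small // eq_sym.
case: eqP => [ab _|_ /eqP-> //].
rewrite /y ab divff ?expf_neq0 //.
by under eq_bigr do rewrite expr1n; rewrite sumr_const card_ord.
Qed.

Lemma fourier_inversion (K : fieldType) (n m : nat) (z w : K)
    (x : grid_vertex n m) :
  n.-primitive_root z -> m.-primitive_root w ->
  \sum_(j < n) \sum_(k < m)
    grid_character (z ^+ j)^-1 (w ^+ k)^-1 x *:
      fun_row (@grid_character K n m (z ^+ j) (w ^+ k)) =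
  (n%:R * m%:R) *: delta_mx 0 (enum_rank x).
Proof.
move=> prim_z prim_w; apply/rowP=> i.
rewrite summxE; under eq_bigr => j _.
  rewrite summxE.
  under eq_bigr do rewrite !mxE /grid_character mulrACA.
  rewrite -mulr_sumr prim_root_orthogonality //.
  over.
rewrite -mulr_suml prim_root_orthogonality // !mxE eqxx /=.
rewrite -(inj_eq enum_val_inj i) enum_rankK.
have -> : (enum_val i == x) = (x.1 == (enum_val i).1) && (x.2 == (enum_val i).2).
  by rewrite eq_sym.
by do 2!case: (_ == _); rewrite /= ?(mulr0n, mulr1n, mulr0, mul0r, mulr1).
Qed.

(** For an orthogonal matrix, |U v - v|^2 = 2 v^T v - 2 v^T U v. *)
Lemma orthogonal_fix (R : realType) (k : nat) (U : 'M[R]_k) (v : 'cV[R]_k) :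
  U^T *m U = 1%:M -> v^T *m U *m v = v^T *m v -> U *m v = v.
Proof.
move=> UU vUv; apply/eqP; rewrite -subr_eq0; set e := _ - _.
have vUTv : v^T *m U^T *m v = v^T *m v.
  by move/(congr1 trmx): vUv; rewrite !trmx_mul !trmxK mulmxA.
have eTe : e^T *m e = 0.
  rewrite /e [(_ - _)^T]linearB /= trmx_mul mulmxBl !mulmxBr !mulmxA.
  by rewrite -(mulmxA _ U^T U) UU mulmx1 vUv vUTv !subrr.
clearbody e; apply/eqP/colP=> i; rewrite [RHS]mxE.
have /matrixP/(_ 0 0) := eTe; rewrite !mxE => /eqP.
rewrite psumr_eq0 => [/allP/(_ i)|j _]; last by rewrite mxE -expr2 sqr_ge0.
by rewrite mem_index_enum mxE mulf_eq0 orbb => /(_ isT)/eqP.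
Qed.

Lemma orthogonal_exp (K : fieldType) (k t : nat) (U : 'M[K]_k) :
  U^T *m U = 1%:M -> (U ^+ t)^T *m U ^+ t = 1%:M.
Proof.
move=> UU; elim: t => [|t IH]; first by rewrite expr0 trmx1 mulmx1.
rewrite exprS [U * _]/(U *m _) trmx_mul -mulmxA [X in _ *m X]mulmxA UU mul1mx.
exact: IH.
Qed.

Lemma characters_periodic (R : realType) (n m t : nat) (z w : R[i]) :
  n.-primitive_root z -> m.-primitive_root w -> (0 < t)%N ->
  (forall z w : R[i], z ^+ n = 1 -> w ^+ m = 1 -> exists u, [/\ u != 0,
     u + u^-1 = 4^-1 * (char_norm z * char_norm w) - 2 & u ^+ t = 1]) ->
  grid_periodic R n m.
Proof.
move=> prim_z prim_w t_gt0 eig x; exists t, 1.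
split; rewrite ?normr1 // scale1r; congr (map_mx _ _).
set U := transition_mx R n m; set v := vertex_state R x.
have nz2 : 2 != 0 :> R by rewrite pnatr_eq0.
have nz2C : 2 != 0 :> R[i] by rewrite pnatr_eq0.
apply: orthogonal_fix.
  apply: orthogonal_exp; rewrite /U transition_mxE.
  apply: reflection_product_orthogonal; first exact: vertex_mx_orthonormal.
  exact: face_mx_orthonormal.
apply: (@map_mx_inj _ _ (real_complex R)).
pose NT := (incidence_mx R[i] (@arc_tail n m))^T.
have vT : map_mx (real_complex R) v^T = delta_mx 0 (enum_rank x) *m NT.
  rewrite /v /vertex_state vertex_mxE trmx_mul trmx_delta map_mxM map_delta_mx.
  by rewrite -map_trmx map_incidence_mx.
rewrite -[_ *m v]mulmxA ![map_mx _ (v^T *m _)]map_mxM vT.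
have nm0 : n%:R * m%:R != 0 :> R[i].
  rewrite mulf_neq0 // pnatr_eq0 -lt0n.
    exact: prim_order_gt0 prim_z.
  exact: prim_order_gt0 prim_w.
(* By Fourier inversion it suffices to compare both sides after replacing the
   row e_x^T by each character. *)
apply: (scalerI nm0); rewrite !scalemxAl.
rewrite -(fourier_inversion x prim_z prim_w) !mulmx_suml.
apply: eq_bigr => j _; rewrite !mulmx_suml; apply: eq_bigr => k _.
rewrite -!scalemxAl; congr (_ *: _).
have zn : (z ^+ j) ^+ n = 1 by rewrite exprAC (prim_expr_order prim_z) expr1n.
have wm : (w ^+ k) ^+ m = 1 by rewrite exprAC (prim_expr_order prim_w) expr1n.
have [u [u0 Eu ut]] := eig _ _ zn wm.
(* The right-hand side is the moment of order 0. *)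
have := character_moments x 0 zn wm u0 Eu; rewrite !expr0 mul1mx -/v => ->.
have := character_moments x t zn wm u0 Eu; rewrite -/U -/v => ->.
by rewrite ut exprVn ut invr1.
Qed.

(** * Roots of unity and algebraic integers *)

Lemma closed_prim_root_exists (C : numClosedFieldType) (n : nat) :
  (0 < n)%N -> exists z : C, n.-primitive_root z.
Proof.
move=> n_gt0; have [r Dp] := closed_field_poly_normal ('X^n - 1 : {poly C}).
rewrite (monicP _) ?monicXnsubC // scale1r in Dp.
have rn1 : all n.-unity_root r.
  by apply/allP=> z; rewrite -root_prod_XsubC -Dp.
have size_r : (n <= size r)%N.
  by rewrite -ltnS -(size_prod_XsubC r id) -Dp size_XnsubC.
have uniq_r : uniq r.
  by rewrite -separable_prod_XsubC -Dp separable_Xn_sub_1 // pnatr_eq0 -lt0n.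
have /hasP[z _ prim_z] := has_prim_root n_gt0 rn1 uniq_r size_r.
by exists z.
Qed.

Lemma inverse_sum_exists (C : numClosedFieldType) (c : C) :
  exists2 u, u != 0 & u + u^-1 = c.
Proof.
pose s := sqrtC (c ^+ 2 - 4); pose u := (c + s) / 2.
have uE : u * (c - u) = 1.
  have s2 : s ^+ 2 = c ^+ 2 - 4 by rewrite sqrtCK.
  transitivity ((c ^+ 2 - s ^+ 2) / 4); first by rewrite /u; field.
  by rewrite s2; field.
have u0 : u != 0 by apply: contra_eq_neq uE => ->; rewrite mul0r eq_sym oner_eq0.
exists u => //; have -> : u^-1 = c - u by rewrite -[RHS](mulKf u0) uE mulr1.
by rewrite addrC subrK.
Qed.

(** Algebraic integers of C: the roots of monic polynomials with coefficients in
    the integers. *)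
Definition integral (C : numFieldType) (x : C) : Prop :=
  integralOver (intmul (1 : C)) x.

Lemma half_not_integral (C : numFieldType) : ~ integral (2^-1 : C).
Proof.
case=> p mon_p rp.
(* The root 1/2 is rational, so it is also a root of p in [algC]. *)
pose q : {poly algC} := map_poly (intmul 1) p.
have rq : root q 2^-1.
  have rQ : root (map_poly (intmul 1) p) (2^-1 : rat).
    rewrite -(fmorph_root (@ratr C)) -map_poly_comp fmorphV rmorph_nat.
    by rewrite (eq_map_poly (g := intmul 1)) // => a; rewrite /= rmorph_int.
  move: rQ; rewrite -(fmorph_root (@ratr algC)) -map_poly_comp fmorphV rmorph_nat.
  by rewrite (eq_map_poly (g := intmul 1)) // => a; rewrite /= rmorph_int.
have : (2^-1 : algC) \in Num.int.
  apply: Cint_rat_Aint; first by rewrite rpredV rpred_nat.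
  apply: root_monic_Aint rq _ _; first exact: monic_map.
  by apply/polyOverP=> i; rewrite coef_map /= intr_int.
case/intrP=> k Ek; have : (1 : algC) = (2 * k)%:~R.
  by rewrite intrM -Ek divff // pnatr_eq0.
by move/(intr_inj (x1 := 1)); lia.
Qed.

Lemma integral_unity_root (C : numFieldType) (t : nat) (u : C) :
  (0 < t)%N -> u ^+ t = 1 -> integral u.
Proof.
move=> t_gt0 ut; exists ('X^t - 1); first exact: monicXnsubC.
rewrite rmorphB /= map_polyXn rmorph1 rootE.
by rewrite !hornerE ut subrr.
Qed.

Lemma char_norm1 (K : fieldType) : char_norm (1 : K) = 4.
Proof. by rewrite /char_norm invr1; ring. Qed.

Lemma char_normN1 (K : fieldType) : char_norm (- 1 : K) = 0.
Proof. by rewrite /char_norm subrr mul0r. Qed.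

Lemma char_norm_sqrN1 (K : fieldType) (z : K) : z ^+ 2 = - 1 -> char_norm z = 2.
Proof.
move=> z2.
have z0 : z != 0.
  by apply: contra_eq_neq z2 => ->; rewrite expr0n /= eq_sym oppr_eq0 oner_eq0.
have -> : char_norm z = (1 + 2 * z + z ^+ 2) / z by rewrite /char_norm; field.
by rewrite z2; field.
Qed.

Lemma char_normE (K : fieldType) (z : K) :
  z != 0 -> char_norm z = 2 + (z + z^-1).
Proof. by move=> z0; rewrite /char_norm; field. Qed.

(** For z of odd order d > 1, z is the power z^(d+1) of z^2, so that
    1 - z = (1 - z^2) g with g a sum of roots of unity; then (1 + z) g = 1 and
    1 + z is a unit among the algebraic integers. *)
Lemma char_normV_odd (C : numClosedFieldType) (d : nat) : odd d -> (1 < d)%N ->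
  exists z : C, [/\ z ^+ d = 1, char_norm z != 0 & integral (char_norm z)^-1].
Proof.
move=> d_odd d_gt1; have d_gt0 := ltnW d_gt1.
have [z prim_z] := closed_prim_root_exists C d_gt0.
have zd := prim_expr_order prim_z.
have z_neq1 : z != 1.
  by rewrite -(expr0 z) -{1}[z]expr1 (eq_prim_root_expr prim_z) mod0n modn_small.
have inv1D (y : C) : y ^+ d = 1 -> y != 1 ->
    exists2 g, (1 + y) * g = 1 & integral g.
  move=> yd y_neq1; pose k := uphalf d.
  exists (\sum_(i < k) (y ^+ 2) ^+ i).
    have yk : (y ^+ 2) ^+ k = y.
      have dk : (2 * k = d.+1)%N.
        by rewrite /k uphalf_half; have := odd_double_half d; lia.
      by rewrite -exprM dk exprS yd mulr1.
    have := subrX1 (y ^+ 2) k; rewrite yk => E.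
    have y1 : y - 1 != 0 by rewrite subr_eq0.
    by apply: (mulfI y1); rewrite mulr1 {2}E; ring.
  elim/big_ind: _ => [|a b|i _]; first exact: integral0.
    exact: integral_add.
  apply: (@integral_unity_root _ d) => //.
  by rewrite -!exprM mulnC exprM yd expr1n.
have [g gE gI] := inv1D z zd z_neq1.
have [h hE hI] : exists2 h, (1 + z^-1) * h = 1 & integral h.
  by apply: inv1D; rewrite ?exprVn ?zd ?invr1 // invr_eq1.
have E : char_norm z * (g * h) = 1 by rewrite /char_norm mulrACA gE hE mulr1.
have nz : char_norm z != 0.
  by apply: contra_eq_neq E => ->; rewrite mul0r eq_sym oner_eq0.
exists z; split=> //.
have -> : (char_norm z)^-1 = g * h by rewrite -[RHS](mulKf nz) E mulr1.
exact: integral_mul.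
Qed.

(** * Both dimensions greater than two *)

(** The integrality condition on the characters that periodicity imposes. *)
Definition characters_integral (C : numClosedFieldType) (n m : nat) : Prop :=
  forall z w : C, z ^+ n = 1 -> w ^+ m = 1 ->
    integral (4^-1 * (char_norm z * char_norm w)).

Lemma characters_integralC (C : numClosedFieldType) (n m : nat) :
  characters_integral C n m -> characters_integral C m n.
Proof. by move=> H z w zm wn; rewrite [char_norm z * _]mulrC; apply: H. Qed.

Lemma periodic_at_integral (R : realType) (n m : nat) (x : grid_vertex n m) :
  periodic_at R x -> characters_integral R[i] n m.
Proof.
move=> /periodic_at_characters[t t_gt0 Ht] z w zn wm.
have [u u0 Eu] := inverse_sum_exists (4^-1 * (char_norm z * char_norm w) - 2).
have ut := Ht z w u zn wm u0 Eu.
rewrite -[X in integral X](subrK 2) -Eu.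
apply: integral_add; last exact: integral_nat.
apply: integral_add; first exact: integral_unity_root ut.
by apply: (integral_unity_root t_gt0); rewrite exprVn ut invr1.
Qed.

Lemma order_trichotomy (k : nat) : (2 < k)%N ->
  [\/ exists d, [/\ odd d, (1 < d)%N & (d %| k)%N], k = 4%N | (8 %| k)%N].
Proof.
move=> k_gt2; have k_gt0 : (0 < k)%N by apply: leq_trans k_gt2.
have [d] := pfactor_coprime (isT : prime 2) k_gt0.
rewrite coprime2n => d_odd k_eq.
have [d_gt1|d_le1] := ltnP 1 d.
  by constructor 1; exists d; split=> //; rewrite k_eq dvdn_mulr.
have d1 : d = 1%N by case: d d_odd d_le1 {k_eq} => [|[]].
move: k_eq k_gt2; rewrite d1 mul1n; case: (logn 2 k) => [|[|[|e]]] -> // _.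
  by constructor 2.
by constructor 3; rewrite (@dvdn_exp2l 2 3).
Qed.

Lemma unity_root_dvd (K : fieldType) (d n : nat) (z : K) :
  (d %| n)%N -> z ^+ d = 1 -> z ^+ n = 1.
Proof. by case/dvdnP=> k -> zd; rewrite mulnC exprM zd expr1n. Qed.

Lemma imaginary_unity_root (C : numClosedFieldType) (n : nat) :
  (4 %| n)%N -> 'i ^+ n = 1 :> C.
Proof.
by move/unity_root_dvd; apply; rewrite (exprM 'i 2 2) sqrCi sqrrN expr1n.
Qed.

(** With z of odd order and w such that 2 / A(w) is integral, A(z) A(w) / 4
    times (1 / A(z)) (2 / A(w)) is 1/2. *)
Lemma integral_odd_divisor (C : numClosedFieldType) (n m d : nat) :
  odd d -> (1 < d)%N -> (d %| n)%N -> (2 < m)%N -> ~ characters_integral C n m.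
Proof.
move=> d_odd d_gt1 dn m_gt2 H.
have [w [wm w0 wI]] : exists w : C,
    [/\ w ^+ m = 1, char_norm w != 0 & integral (2 / char_norm w)].
  have i_root : (4 %| m)%N -> exists w : C,
      [/\ w ^+ m = 1, char_norm w != 0 & integral (2 / char_norm w)].
    move=> m4; exists 'i; rewrite char_norm_sqrN1 ?sqrCi // divff ?pnatr_eq0 //.
    by split; [exact: imaginary_unity_root | | exact: integral1].
  case: (order_trichotomy m_gt2) => [[e [e_odd e_gt1 em]]|m4|m8].
  - have [w [we w0 wI]] := char_normV_odd C e_odd e_gt1.
    exists w; split=> //; first exact: unity_root_dvd we.
    by apply: integral_mul => //; apply: integral_nat.
  - by apply: i_root; rewrite m4.
  - by apply: i_root; apply: dvdn_trans m8.
have [z [zd z0 zI]] := char_normV_odd C d_odd d_gt1.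
have zn := unity_root_dvd dn zd.
apply: (@half_not_integral C).
have -> : 2^-1 = 4^-1 * (char_norm z * char_norm w) *
    ((char_norm z)^-1 * (2 / char_norm w)).
  by field; rewrite z0 w0.
by apply: integral_mul; [apply: H | apply: integral_mul].
Qed.

(** For w of order 8, A('i) A(w) / 4 - 1 = (w + w^-1) / 2, whose square is
    1/2. *)
Lemma integral_eighth_root (C : numClosedFieldType) (n m : nat) :
  (4 %| n)%N -> (8 %| m)%N -> ~ characters_integral C n m.
Proof.
move=> n4 m8 H.
have [w prim_w] := closed_prim_root_exists C (isT : (0 < 8)%N).
have w8 := prim_expr_order prim_w.
have w0 : w != 0 by apply: unity_root_neq0 w8.
have w4 : w ^+ 4 = -1.
  have : (w ^+ 4) ^+ 2 == 1 by rewrite -exprM w8.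
  rewrite sqrf_eq1 => /orP[|/eqP//].
  by rewrite -(expr0 w) (eq_prim_root_expr prim_w).
have sI : integral (2^-1 * (w + w^-1)).
  have -> : 2^-1 * (w + w^-1) = 4^-1 * (char_norm 'i * char_norm w) - 1.
    by rewrite (char_norm_sqrN1 (sqrCi C)) char_normE //; field.
  apply: integral_sub; last exact: integral1.
  by apply: H; [exact: imaginary_unity_root | exact: unity_root_dvd w8].
apply: (@half_not_integral C).
have -> : 2^-1 = (2^-1 * (w + w^-1)) * (2^-1 * (w + w^-1)).
  transitivity ((w ^+ 4 + 2 * w ^+ 2 + 1) / (4 * w ^+ 2)); last by field.
  by rewrite w4; field.
exact: integral_mul.
Qed.

Lemma characters_integral_four (C : numClosedFieldType) (n m : nat) :
  (2 < n)%N -> (2 < m)%N -> characters_integral C n m -> n = 4%N /\ m = 4%N.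
Proof.
move=> n_gt2 m_gt2 H; have H' := characters_integralC H.
have no_odd (k l : nat) : (2 < l)%N -> characters_integral C k l ->
    ~ exists d, [/\ odd d, (1 < d)%N & (d %| k)%N].
  move=> l_gt2 Hkl [d [d_odd d_gt1 dk]].
  exact: (integral_odd_divisor d_odd d_gt1 dk l_gt2 Hkl).
case: (order_trichotomy n_gt2) (order_trichotomy m_gt2) => [On|n4|n8].
- by case: (no_odd n m).
- case=> [Om|//|m8]; first by case: (no_odd m n).
  by case: (integral_eighth_root (n := n) _ m8 H); rewrite n4.
- case=> [Om|m4|m8]; first by case: (no_odd m n).
    by case: (integral_eighth_root (n := m) _ n8 H'); rewrite m4.
  by case: (integral_eighth_root (dvdn_trans _ n8) m8 H).
Qed.

(** * The periodic cases *)

Lemma characters_periodic_small (C : numClosedFieldType) (n m : nat) (z w : C) :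
  (0 < m)%N -> (0 < n <= 2)%N -> z ^+ n = 1 -> w ^+ m = 1 ->
  exists u, [/\ u != 0, u + u^-1 = 4^-1 * (char_norm z * char_norm w) - 2 &
    u ^+ (2 * m) = 1].
Proof.
move=> m_gt0 n_le2 zn wm.
have : z == 1 \/ z == -1.
  apply/orP; rewrite -sqrf_eq1; apply/eqP/(unity_root_dvd _ zn).
  by case: (n) n_le2 => [|[|[|]]].
case=> /eqP->.
  have w0 := unity_root_neq0 m_gt0 wm; exists w; split=> //.
    by rewrite char_norm1 char_normE //; field.
  by rewrite mulnC exprM wm expr1n.
exists (-1); rewrite oppr_eq0 oner_eq0 char_normN1; split=> //.
  by rewrite invrN1 mul0r mulr0; ring.
by rewrite exprM sqrrN !expr1n.
Qed.

Lemma char_norm_fourth_root (K : fieldType) (z : K) : z ^+ 4 = 1 ->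
  [\/ char_norm z = 4, char_norm z = 0 | char_norm z = 2].
Proof.
move=> z4; have : (z ^+ 2) ^+ 2 == 1 by rewrite -exprM z4.
rewrite sqrf_eq1 sqrf_eq1 -orbA => /or3P[] /eqP z_eq.
- by constructor 1; rewrite z_eq char_norm1.
- by constructor 2; rewrite z_eq char_normN1.
- by constructor 3; apply: char_norm_sqrN1.
Qed.

Lemma characters_periodic_four (C : numClosedFieldType) (z w : C) :
  z ^+ 4 = 1 -> w ^+ 4 = 1 ->
  exists u, [/\ u != 0, u + u^-1 = 4^-1 * (char_norm z * char_norm w) - 2 &
    u ^+ 12 = 1].
Proof.
move=> z4 w4.
have norms (c : C) : [\/ c = 4, c = 0, c = 2 | c = 1] ->
    exists u, [/\ u != 0, u + u^-1 = c - 2 & u ^+ 12 = 1].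
  case=> ->.
  - by exists 1; rewrite oner_eq0 invr1 expr1n; split=> //; ring.
  - exists (-1); rewrite oppr_eq0 oner_eq0 invrN1 (exprM _ 2 6) sqrrN !expr1n.
    by split=> //; ring.
  - exists 'i; rewrite neq0Ci invCi imaginary_unity_root //; split=> //.
    by rewrite !subrr.
  have [u u0 Eu] := inverse_sum_exists (1 - 2 : C); exists u; split=> //.
  have u2 : u ^+ 2 = - u - 1.
    transitivity ((u + u^-1) * u - 1); first by field.
    by rewrite Eu; ring.
  have u3 : u ^+ 3 = 1 by rewrite exprS u2 mulrBr mulrN -expr2 u2; ring.
  by rewrite (exprM _ 3 4) u3 expr1n.
apply: norms.
case: (char_norm_fourth_root z4) (char_norm_fourth_root w4) => -> [] ->.
- by constructor 1; field.
- by constructor 2; field.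
- by constructor 3; field.
- by constructor 2; field.
- by constructor 2; field.
- by constructor 2; field.
- by constructor 3; field.
- by constructor 2; field.
- by constructor 4; field.
Qed.

Theorem theorem6p1 (R : realType) (n m : nat) (n_ge1 : (1 <= n)%N)
    (m_ge1 : (1 <= m)%N) :
  grid_periodic R n m <->
  ((minn n m <= 2)%N \/ (n = 4%N /\ m = 4%N)).
Proof.
have [z prim_z] := closed_prim_root_exists R[i] n_ge1.
have [w prim_w] := closed_prim_root_exists R[i] m_ge1.
split=> [per|].
  have := periodic_at_integral (per (Ordinal n_ge1, Ordinal m_ge1)).
  rewrite geq_min; have [n_le2|n_gt2] := leqP n 2; first by left.
  have [m_le2|m_gt2] := leqP m 2; first by left.
  by move=> H; right; apply: characters_integral_four H.
rewrite geq_min => -[/orP[n_le2|m_le2]|[n4 m4]].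
- apply: (characters_periodic (t := 2 * m) prim_z prim_w).
    by rewrite muln_gt0.
  by move=> z' w'; apply: characters_periodic_small; rewrite ?n_ge1.
- apply: (characters_periodic (t := 2 * n) prim_z prim_w).
    by rewrite muln_gt0.
  move=> z' w' zn wm; rewrite [char_norm z' * _]mulrC.
  by apply: characters_periodic_small wm zn; rewrite ?m_ge1.
- apply: (characters_periodic (t := 12) prim_z prim_w) => //.
  by rewrite n4 m4 => z' w'; apply: characters_periodic_four.
Qed.
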